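(* Let $r=\{r_j\}_{j=1}^\infty$ be a sequence of integers with $r_j\ge 2$ for each $j$ (not necessarily bounded), and let $Y$, $Y_0$, $\rho$, $D$ and $A:\mathbf{R}\times Y_0\to Y$ be as defined in the context. For $u,v\in Y$ put $$\Delta(u,v)=\inf\{D((a,x),(b,y)) : (a,x),(b,y)\in\mathbf{R}\times Y_0,\ A(a,x)=u,\ A(b,y)=v\}.$$ Then the following hold. (1) $\Delta$ is a metric on $Y$ which is invariant under translations of the group $Y$, and the infimum defining $\Delta(u,v)$ is attained for all $u,v\in Y$. (2) $\Delta(A(a,x),A(b,y))\le D((a,x),(b,y))$ for all $(a,x),(b,y)\in\mathbf{R}\times Y_0$. (3) $\Delta(x,y)=\rho(x,y)$ for all $x,y\in Y_0$, where $Y_0$ is regarded as a subgroup of $Y$. (4) $\Delta(u,v)\le 1$ for all $u,v\in Y$. (5) $D((a,x),(b,y))\le 2\,\Delta(A(a,x),A(b,y))$ for all $(a,x),(b,y)\in\mathbf{R}\times Y_0$ with $|a-b|\le 1/2$.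
   Context: Let $r=\{r_j\}_{j=1}^\infty$ be a sequence of integers $\ge 2$; put $R_0=1$ and $R_l=\prod_{j=1}^l r_j$ for $l\ge 1$. Let $X=\prod_{l=0}^\infty(\mathbf{R}/R_l\mathbf{Z})$, a commutative group under coordinatewise addition. A sequence $x=\{x_l\}_{l=0}^\infty\in X$ is coherent if, for each $l\ge 0$, $x_l$ is the image of $x_{l+1}$ under the natural homomorphism $\mathbf{R}/R_{l+1}\mathbf{Z}\to\mathbf{R}/R_l\mathbf{Z}$. Let $Y\subseteq X$ be the subgroup of coherent sequences. Let $Y_0$ be the set of coherent sequences in $X_0=\prod_{l=1}^\infty(\mathbf{Z}/R_l\mathbf{Z})$, that is, sequences $\{x_l\}_{l=1}^\infty$ such that $x_l$ is the image of $x_{l+1}$ under $\mathbf{Z}/R_{l+1}\mathbf{Z}\to\mathbf{Z}/R_l\mathbf{Z}$ for each $l\ge 1$. Identify $Y_0$ with the subgroup $\{y\in Y: y_0=0\}$ of $Y$ by setting $x_0=0$ in $\mathbf{R}/\mathbf{Z}$. For distinct $x,y\in X_0$, let $l(x,y)$ be the smallest positive integer $l$ with $x_l\ne y_l$, and put $\rho(x,y)=1/R_{l(x,y)-1}$; put $\rho(x,x)=0$. This is a translation-invariant ultrametric. Let $q:\mathbf{R}\to Y$ be the homomorphism $q(a)=\{q_l(a)\}_{l=0}^\infty$, where $q_l:\mathbf{R}\to\mathbf{R}/R_l\mathbf{Z}$ is the quotient map. Define $A:\mathbf{R}\times Y_0\to Y$ by $A(a,x)=q(a)+x$, the sum being taken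 in $Y$; this is a surjective homomorphism. The metric $D$ on $\mathbf{R}\times Y_0$ is $D((a,x),(b,y))=\max(|a-b|,\rho(x,y))$. *)

(* Defs.v *)
From HB Require Import structures.
From mathcomp Require Import all_boot all_order all_algebra.
From mathcomp Require Import boolp classical_sets reals.

Set Implicit Arguments.
Unset Strict Implicit.
Unset Printing Implicit Defensive.

Import Order.TTheory GRing.Theory Num.Theory.
Local Open Scope classical_set_scope.
Local Open Scope ring_scope.
Local Open Scope quotient_scope.

(* The sequence is r_1, r_2, ...; the value [r 0] is never used. *)
Definition Rprod (r : nat -> nat) (l : nat) : nat := \prod_(1 <= j < l.+1) r j.

Lemma dvd_Rprod r l : (Rprod r l %| Rprod r l.+1)%N.
Proof. by rewrite /Rprod [X in (_ %| X)%N]big_nat_recr //= dvdn_mulr. Qed.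

(* The subgroup N Z of the additive group of T. *)
Definition multiples (T : pzRingType) (N : nat) : {pred T} :=
  fun x => `[< exists k : int, x = N%:R *~ k >].
Arguments multiples T N : clear implicits.

Lemma multiplesP (T : pzRingType) (N : nat) (x : T) :
  reflect (exists k : int, x = N%:R *~ k) (x \in multiples T N).
Proof. exact: asboolP. Qed.

Fact multiples_zmod_closed (T : pzRingType) (N : nat) :
  zmod_closed (multiples T N).
Proof.
split=> [|x y /multiplesP[j ->] /multiplesP[k ->]]; apply/multiplesP.
  by exists 0; rewrite mulr0z.
by exists (j - k); rewrite mulrzBr.
Qed.

HB.instance Definition _ (T : pzRingType) (N : nat) :=
  GRing.isZmodClosed.Build T (multiples T N) (multiples_zmod_closed T N).

(* The quotient group T / N Z: R / N Z for T = R, and Z / N Z for T = int. *)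
Notation residue T N := (Quotient.quot (multiples T N)).

Lemma eq_residue (T : pzRingType) (N : nat) (a b : T) :
  \pi_(residue T N) a = \pi_(residue T N) b <->
  exists k : int, a - b = N%:R *~ k.
Proof.
split=> [/eqP|h]; first by rewrite -Quotient.idealrBE => /multiplesP.
by apply/eqP; rewrite -Quotient.idealrBE; apply/multiplesP.
Qed.

Lemma residueB (T : pzRingType) (N : nat) (a b : T) :
  \pi_(residue T N) (a - b) = \pi_(residue T N) a - \pi_(residue T N) b.
Proof. by rewrite Quotient.pi_add Quotient.pi_opp. Qed.

Lemma residue0 (T : pzRingType) (N : nat) : \pi_(residue T N) (0 : T) = 0.
Proof. by rewrite -(subrr 0) residueB subrr. Qed.

(* The natural map T / M Z -> T / N Z; it depends only on the class, and is a
   group homomorphism, when N divides M: see [reduceE]. *)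
Definition reduce (T : pzRingType) (M N : nat) (x : residue T M) :
  residue T N := \pi_(residue T N) (repr x).

Lemma reduceE (T : pzRingType) (M N : nat) (a : T) : (N %| M)%N ->
  reduce N (\pi_(residue T M) a) = \pi_(residue T N) a.
Proof.
move=> /dvdnP[c ->]; apply/eq_residue.
have /eq_residue[k ->] : \pi_(residue T (c * N)) (repr (\pi_(residue T (c * N)) a))
   = \pi_(residue T (c * N)) a by rewrite reprK.
by exists (c%:Z * k); rewrite mulnC natrM mulrzA -pmulrn mulr_natr.
Qed.

Lemma reduceB (T : pzRingType) (M N : nat) (x y : residue T M) : (N %| M)%N ->
  reduce N (x - y) = reduce N x - reduce N y.
Proof.
by move=> NM; rewrite -[x]reprK -[y]reprK -residueB !reduceE// residueB.
Qed.

(* The product of the T / R_l Z over l >= s; the coordinate of index l = s + i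
   is stored at position i. *)
Definition residues (T : pzRingType) (r : nat -> nat) (s : nat) : Type :=
  forall i : nat, residue T (Rprod r (s + i)).

Section residues_zmodType.
Context (T : pzRingType) (r : nat -> nat) (s : nat).
Local Notation X := (residues T r s).

HB.instance Definition _ := gen_eqMixin X.
HB.instance Definition _ := gen_choiceMixin X.

Let zero : X := fun=> 0.
Let opp (x : X) : X := fun i => - x i.
Let add (x y : X) : X := fun i => x i + y i.

Let addA : associative add.
Proof. by move=> x y z; apply: functional_extensionality_dep => i; exact: addrA. Qed.
Let addC : commutative add.
Proof. by move=> x y; apply: functional_extensionality_dep => i; exact: addrC. Qed.
Let add0 : left_id zero add.
Proof. by move=> x; apply: functional_extensionality_dep => i; exact: add0r. Qed.
Let addN : left_inverse zero opp add.
Proof. by move=> x; apply: functional_extensionality_dep => i; exact: addNr. Qed.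

HB.instance Definition _ := GRing.isZmodule.Build X addA addC add0 addN.

Definition coherent : {pred X} :=
  fun x => `[< forall i, x i = reduce (Rprod r (s + i)) (x i.+1) >].

Lemma coherentP (x : X) :
  reflect (forall i, x i = reduce (Rprod r (s + i)) (x i.+1)) (x \in coherent).
Proof. exact: asboolP. Qed.

Fact coherent_zmod_closed : zmod_closed coherent.
Proof.
have NM i : (Rprod r (s + i) %| Rprod r (s + i.+1))%N.
  by rewrite addnS dvd_Rprod.
split=> [|x y /coherentP hx /coherentP hy]; apply/coherentP => i.
  by have := @reduceB T _ _ 0 0 (NM i); rewrite !subrr.
transitivity (x i - y i) => //.
by rewrite (hx i) (hy i) -(reduceB _ _ (NM i)).
Qed.

HB.instance Definition _ :=
  GRing.isZmodClosed.Build X coherent coherent_zmod_closed.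

Record cohseq := Cohseq { cohval :> X; cohvalP : cohval \in coherent }.

Definition coord (x : cohseq) (i : nat) : residue T (Rprod r (s + i)) :=
  cohval x i.
Coercion coord : cohseq >-> Funclass.

HB.instance Definition _ := [isSub for cohval].
HB.instance Definition _ := [Choice of cohseq by <:].
HB.instance Definition _ := [SubChoice_isSubZmodule of cohseq by <:].

Lemma cohseqP (x : cohseq) i : x i = reduce (Rprod r (s + i)) (x i.+1).
Proof. exact/coherentP/cohvalP. Qed.

Lemma cohseq_eq (x y : cohseq) : (forall i, x i = y i) -> x = y.
Proof.
by move=> xy; apply: val_inj; apply: functional_extensionality_dep.
Qed.

End residues_zmodType.
Arguments coherent T r s : clear implicits.

Definition X0 (r : nat -> nat) : Type := residues int r 1.
Notation Y0 r := (cohseq int r 1).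
Notation Y R r := (cohseq R r 0).

Section solenoid.
Context (R : realType) (r : nat -> nat).

(* The map Z / N Z -> R / N Z induced by the inclusion of Z in R. *)
Definition residueR (N : nat) (x : residue int N) : residue R N :=
  \pi_(residue R N) (repr x)%:~R.

Lemma residueRE (N : nat) (m : int) :
  residueR (\pi_(residue int N) m) = \pi_(residue R N) m%:~R.
Proof.
have /eq_residue[k hk] : \pi_(residue int N) (repr (\pi_(residue int N) m))
   = \pi_(residue int N) m by rewrite reprK.
by apply/eq_residue; exists k; rewrite -intrB hk natz mulrzz intrM mulrzr.
Qed.

Lemma residueR_inj (N : nat) : injective (@residueR N).
Proof.
move=> x y; rewrite -[x]reprK -[y]reprK !residueRE => /eq_residue[k hk].
apply/eq_residue; exists k; apply: (@intr_inj R).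
by rewrite intrB hk natz mulrzz intrM mulrzr.
Qed.

Lemma residueR_reduce (M N : nat) (x : residue int M) : (N %| M)%N ->
  residueR (reduce N x) = reduce N (residueR x).
Proof. by move=> NM; rewrite residueRE reduceE. Qed.

(* The identification of Y0 with a subgroup of Y, putting 0 at index 0. *)
Definition embed_val (x : Y0 r) : residues R r 0 :=
  fun l => if l is i.+1 then residueR (x i) else 0.

Fact embed_coherent (x : Y0 r) : embed_val x \in coherent R r 0.
Proof.
apply/coherentP=> -[|i] /=.
  rewrite /residueR reduceE ?dvd_Rprod// -residue0.
  apply/eq_residue; exists (- repr (x 0%N)).
  have -> : Rprod r (0 + 0) = 1%N by rewrite /Rprod big_geq.
  by rewrite sub0r mulrNz.
by rewrite (cohseqP x i) residueR_reduce// dvd_Rprod.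
Qed.

Definition embed (x : Y0 r) : Y R r := Cohseq (embed_coherent x).

Definition q_val (a : R) : residues R r 0 :=
  fun l => \pi_(residue R (Rprod r (0 + l))) a.

Fact q_coherent (a : R) : q_val a \in coherent R r 0.
Proof. by apply/coherentP=> l; rewrite /q_val reduceE// dvd_Rprod. Qed.

Definition q (a : R) : Y R r := Cohseq (q_coherent a).

Definition A (p : R * Y0 r) : Y R r := q p.1 + embed p.2.

(* Position i holds the coordinate of index i + 1, so [ex_minn h] is
   l(x,y) - 1, and the value is 1 / R_(l(x,y) - 1). *)
Definition rho (x y : X0 r) : R :=
  if pselect (exists i, x i != y i) is left h
  then (Rprod r (@ex_minn (fun i => x i != y i) h))%:R^-1
  else 0.

Definition D (p p' : R * Y0 r) : R :=
  Num.max `|p.1 - p'.1| (rho p.2 p'.2).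

Definition Delta (u v : Y R r) : R :=
  inf [set d | exists p p', [/\ A p = u, A p' = v & d = D p p']].

Lemma embed_inj : injective embed.
Proof.
move=> x y xy; apply: cohseq_eq => i; apply: residueR_inj.
exact: (congr1 (fun z : Y R r => z i.+1) xy).
Qed.

Lemma embedB : {morph embed : x y / x - y}.
Proof.
move=> x y; apply: cohseq_eq => -[|i]; first exact/esym/subrr.
rewrite -[LHS]/(residueR (x i - y i)) -[RHS]/(residueR (x i) - residueR (y i)).
by rewrite -[x i]reprK -[y i]reprK -residueB !residueRE -residueB intrB.
Qed.

Lemma embed_image (y : Y R r) : y 0%N = 0 <-> exists x, y = embed x.
Proof.
split=> [y0|[x ->]//].
have hm l : exists m : int, y l = \pi_(residue R (Rprod r (0 + l))) m%:~R.
  elim: l => [|l [m hl]]; first by exists 0; rewrite y0 residue0.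
  have : \pi_(residue R (Rprod r (0 + l))) (repr (y l.+1)) =
         \pi_(residue R (Rprod r (0 + l))) m%:~R by rewrite -hl (cohseqP y l).
  move=> /eq_residue[k /eqP]; rewrite subr_eq => /eqP hk.
  exists ((Rprod r (0 + l))%:Z * k + m).
  by rewrite intrD intrM mulrzr -hk reprK.
pose m l := projT1 (cid (hm l)).
have ym l : y l = \pi_(residue R (Rprod r (0 + l))) (m l)%:~R.
  exact: projT2 (cid (hm l)).
pose x : residues int r 1 := fun i => \pi_(residue int (Rprod r (1 + i))) (m i.+1).
have xco : x \in coherent int r 1.
  apply/coherentP => i; apply: residueR_inj.
  rewrite residueR_reduce ?dvd_Rprod// !residueRE.
  by have := cohseqP y i.+1; rewrite !ym.
exists (Cohseq xco); apply: cohseq_eq => -[|i]; first exact: y0.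
by rewrite ym -[RHS]/(residueR (x i)) residueRE.
Qed.

End solenoid.

Arguments D {R r} p p'.
Arguments Delta {R r} u v.

Definition is_metric (K : numDomainType) (T : Type) (d : T -> T -> K) : Prop :=
  [/\ forall x y, 0 <= d x y,
      forall x y, d x y = 0 <-> x = y,
      forall x y, d x y = d y x &
      forall x y z, d x z <= d x y + d y z].

(* Main.v *)
Require Import Defs.
From mathcomp Require Import all_boot all_order all_algebra.
From mathcomp Require Import boolp classical_sets reals.
From mathcomp Require Import zify lra.

(** D is a translation-invariant metric on R x Y0, so Delta(u,v) is the
    infimum of the norm D(s,0) over the fibre of the homomorphism A above
    u - v ([D_sub], [AB]), and everything rests on the shape of the fibres.
    The value A(a,x) has coordinate a at index 0, and the kernel of A is
    infinite cyclic, its elements having the integers as first coordinates: the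
    fibre over w has exactly one point over each real lift of w_0 in R/Z
    ([A_onto], [A_inj], [A_eq_int]).

    Every fibre therefore contains a point s whose real coordinate is at most
    1/2 in absolute value.  Since rho <= 1, its norm is at most 1, whereas
    translating the real coordinate by an integer of absolute value at least 2
    gives norm at least 3/2.  Hence the infimum is a minimum over three points
    ([A_min], [Delta_min]), and definiteness and the triangle inequality for
    Delta follow from those of D at points where minima are attained.

    The comparisons between Delta and D come from one dichotomy: a point s of
    the fibre above A(p) - A(p') either is p - p', or its real coordinate
    differs from that of p - p' by a nonzero integer, so that
    1 <= |p.1 - p'.1| + D(s,0) ([fibre_dichotomy]).  For real coordinates both
    0 this gives Delta = rho, as rho <= 1; for |p.1 - p'.1| <= 1/2 it gives
    D(s,0) >= 1/2, while D(p,p') <= 1. *)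

Set Implicit Arguments.
Unset Strict Implicit.
Unset Printing Implicit Defensive.

Import Order.TTheory GRing.Theory Num.Theory.
Local Open Scope ring_scope.
Local Open Scope quotient_scope.

(** * The ultrametric on sequences of residues *)

Lemma Rprod_gt0 (r : nat -> nat) (l : nat) :
  (forall j, (1 <= j)%N -> (2 <= r j)%N) -> (0 < Rprod r l)%N.
Proof.
move=> r_ge2; rewrite /Rprod big_nat_cond prodn_cond_gt0// => j.
by case/andP=> /andP[/r_ge2 /ltnW].
Qed.

Lemma leq_Rprod (r : nat -> nat) (l m : nat) :
  (forall j, (1 <= j)%N -> (2 <= r j)%N) ->
  (l <= m)%N -> (Rprod r l <= Rprod r m)%N.
Proof.
move=> r_ge2; elim: m => [|m IHm]; first by rewrite leqn0 => /eqP->.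
rewrite leq_eqVlt => /predU1P[->//|/IHm lem]; apply: leq_trans lem _.
by apply: dvdn_leq (dvd_Rprod r m); exact: Rprod_gt0.
Qed.

Section rho_ultrametric.
Context (R : realType) (r : nat -> nat).
Implicit Types x y z : X0 r.

(** [rho] sees its arguments only through the predicate locating the indices
    where they differ; symmetry and translation invariance are instances. *)
Lemma eq_rho x y x' y' : (forall i, (x i == y i) = (x' i == y' i)) ->
  rho R x y = rho R x' y'.
Proof.
pose F (P : pred nat) : R := if pselect (exists i, P i) is left h
  then (Rprod r (ex_minn h))%:R^-1 else 0.
move=> xy; rewrite -[LHS]/(F (fun i => x i != y i)).
by congr F; apply/funext => i; rewrite xy.
Qed.

Lemma rhoC x y : rho R x y = rho R y x.
Proof. by apply: eq_rho => i; rewrite eq_sym. Qed.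

Lemma rhoB (x y : Y0 r) : rho R (x - y) (0 : Y0 r) = rho R x y.
Proof.
apply: eq_rho => i.
by rewrite -[LHS]/(x i - y i == 0) subr_eq0.
Qed.

Lemma rhoP x y : (forall i, x i = y i) /\ rho R x y = 0 \/
  exists i, x i != y i /\ rho R x y = (Rprod r i)%:R^-1.
Proof.
rewrite /rho; case: pselect => [h|nxy].
  by right; case: ex_minnP => i xyi _; exists i.
left; split=> // i; apply/eqP/negPn/negP => xyi; apply: nxy; by exists i.
Qed.

Lemma rho_ge0 x y : 0 <= rho R x y.
Proof. by case: (rhoP x y) => [[_ ->//]|[i [_ ->]]]; rewrite invr_ge0. Qed.

Hypothesis r_ge2 : forall j : nat, (1 <= j)%N -> (2 <= r j)%N.

Lemma rho_ge x y i : x i != y i -> (Rprod r i)%:R^-1 <= rho R x y.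
Proof.
move=> xyi; rewrite /rho; case: pselect => [h|[]]; last by exists i.
case: ex_minnP => m _ /(_ i xyi) lemi.
rewrite lef_pV2 ?posrE ?ltr0n ?Rprod_gt0// ler_nat.
exact: leq_Rprod.
Qed.

Lemma rho_le1 x y : rho R x y <= 1.
Proof.
case: (rhoP x y) => [[_ ->//]|[i [_ ->]]].
by rewrite invf_le1 ?ltr0n ?ler1n ?Rprod_gt0.
Qed.

Lemma rho_eq0 x y : rho R x y = 0 -> forall i, x i = y i.
Proof.
move=> xy0 i; apply/eqP/negPn/negP => /rho_ge.
by rewrite xy0 leNgt invr_gt0 ltr0n Rprod_gt0.
Qed.

(** Where x and z first differ, y differs from one of them. *)
Lemma rho_ultra x y z : rho R x z <= Num.max (rho R x y) (rho R y z).
Proof.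
rewrite le_max; case: (rhoP x z) => [[_ ->]|[i [xzi ->]]].
  by rewrite rho_ge0.
case: (eqVneq (x i) (y i)) => [xyi|/rho_ge->//].
by rewrite (@rho_ge y z) ?orbT// -xyi.
Qed.

End rho_ultrametric.

(** * Fibres of the sum map *)

Section fibres.
Context (R : realType) (r : nat -> nat).
Implicit Types (p s t : R * Y0 r) (u v w : Y R r).

Lemma qB (a b : R) : q r (a - b) = q r a - q r b.
Proof. by apply: cohseq_eq => l; exact: residueB. Qed.

Lemma AB p p' : A (p - p') = A p - A p'.
Proof. by rewrite /A /= qB embedB opprD addrACA. Qed.

Lemma AD p p' : A (p + p') = A p + A p'.
Proof. by rewrite -[p in RHS](addrK p') AB subrK. Qed.

Lemma A_coord0 p : A p 0%N = \pi_(residue R (Rprod r 0)) p.1.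
Proof. exact: addr0. Qed.

Lemma A_inj p p' : A p = A p' -> p.1 = p'.1 -> p = p'.
Proof.
case: p p' => [a x] [b y] + /= ab; rewrite /A -ab /= => /addrI /embed_inj ->.
by rewrite ab.
Qed.

(** The difference between w and [q r a] vanishes at index 0, hence lies in
    the embedded copy of Y0. *)
Lemma A_onto w (a : R) : w 0%N = \pi_(residue R (Rprod r 0)) a ->
  exists x, A (a, x) = w.
Proof.
move=> w0; have /embed_image[x wx] : (w - q r a) 0%N = 0.
  rewrite -[LHS]/(w 0%N - \pi_(residue R (Rprod r 0)) a).
  by rewrite w0 subrr.
by exists x; rewrite /A /= -wx addrC subrK.
Qed.

Lemma residue1P (a b : R) :
  \pi_(residue R (Rprod r 0)) a = \pi_(residue R (Rprod r 0)) b <->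
  exists n : int, a - b = n%:~R.
Proof.
have -> : Rprod r 0 = 1%N by rewrite /Rprod big_geq.
exact: eq_residue.
Qed.

Lemma A_eq_int p p' : A p = A p' -> exists n : int, p.1 - p'.1 = n%:~R.
Proof. by move=> pp'; apply/residue1P; rewrite -!A_coord0 pp'. Qed.

Lemma A_small w : exists s, A s = w /\ `|s.1| <= 1 / 2.
Proof.
pose b : R := repr (w 0%N); pose n : int := Num.floor (b + 1 / 2).
have [|x wx] := @A_onto w (b - n%:~R).
  rewrite -[LHS]reprK; apply/residue1P; exists n.
  by rewrite opprB addrC subrK.
exists (b - n%:~R, x); split=> //=.
have := Num.Theory.floor_le (b + 1 / 2).
have := Num.Theory.floorD1_gt (b + 1 / 2).
rewrite -/n intrD ler_norml; lra.
Qed.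

Lemma A_shift s (n : int) : exists t, A t = A s /\ t.1 = s.1 + n%:~R.
Proof.
have [|x ex] := @A_onto (A s) (s.1 + n%:~R); last by exists (s.1 + n%:~R, x).
rewrite A_coord0; apply/residue1P; exists (- n).
by rewrite opprD addrA subrr add0r mulrNz.
Qed.

End fibres.

(** * The quotient metric *)

Section quotient_metric.
Context (R : realType) (r : nat -> nat).
Hypothesis r_ge2 : forall j : nat, (1 <= j)%N -> (2 <= r j)%N.
Implicit Types (p s t : R * Y0 r) (u v w : Y R r).

Lemma D_sub p p' : D p p' = D (p - p') 0.
Proof. by rewrite /D /= subr0 rhoB. Qed.

Lemma D_fst p p' : `|p.1 - p'.1| <= D p p'.
Proof. by rewrite /D le_max lexx. Qed.

Lemma DC p p' : D p p' = D p' p.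
Proof. by rewrite /D distrC rhoC. Qed.

Lemma D_eq0 p p' : D p p' = 0 -> p = p'.
Proof.
move=> D0; have D0le : D p p' <= 0 by rewrite D0.
move: D0le; rewrite /D ge_max normr_le0 subr_eq0 => /andP[/eqP e1 rho0].
have {rho0} : rho R p.2 p'.2 = 0 by apply/eqP; rewrite eq_le rho0 rho_ge0.
move=> /(rho_eq0 r_ge2) e2; case: p p' e1 e2 {D0} => [a x] [b y] /= -> xy.
by congr pair; exact: cohseq_eq.
Qed.

Lemma D_triangle p p' p'' : D p p'' <= D p p' + D p' p''.
Proof.
rewrite {1}/D ge_max (le_trans (ler_distD p'.1 _ _)) ?lerD ?D_fst//=.
apply: le_trans (rho_ultra R r_ge2 _ p'.2 _) _.
have ge0 s t : 0 <= D s t by exact: le_trans (normr_ge0 _) (D_fst s t).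
by rewrite ge_max ler_wpDr ?ler_wpDl// /D le_max lexx orbT.
Qed.

(** Starting from a point s of the fibre with real coordinate at most 1/2 in
    absolute value, only the translates by -1, 0 and 1 can compete, so a
    minimum over a finite set is enough. *)
Lemma A_min w : exists s, A s = w /\ forall t, A t = w -> D s 0 <= D t 0.
Proof.
have [s [sw s_small]] := A_small w.
have /boolp.choice[f fP] n := A_shift s n.
(* The indices 0, 1, 2 encode the translates by -1, 0, 1. *)
pose g (i : 'I_3) := f (i%:Z - 1).
case: (arg_minP (fun i => D (g i) 0) (erefl (xpredT (1 : 'I_3)))) => m _ mP.
exists (g m); split=> [|t tw]; first by rewrite /g (fP _).1.
have [n tn] : exists n : int, t.1 - s.1 = n%:~R.
  by apply: A_eq_int; rewrite tw.
have tE : t = f n.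
  have [An fn] := fP n.
  by apply: A_inj; rewrite ?An ?fn ?tw// -tn addrC subrK.
have [n_small|n_large] := lerP `|n| 1.
  suff [i ->] : exists i, t = g i by exact: mP.
  rewrite tE; exists (inord `|(n + 1)%R|%N); rewrite /g inordK; last by lia.
  by congr f; lia.
have n2 : 2 <= `|n%:~R| :> R by rewrite -intr_norm (ler_int _ 2).
(* The untranslated point has norm at most 1, while |t.1| >= 2 - 1/2. *)
have s1 : D (f 0) 0 <= 1.
  rewrite /D ge_max rho_le1// (fP 0).2 addr0 subr0 andbT; lra.
apply: le_trans (mP 1 isT) (le_trans s1 _).
apply: le_trans (D_fst t 0); rewrite subr0.
have : `|n%:~R| <= `|t.1| + `|s.1| :> R by rewrite -tn ler_normB.
lra.
Qed.

Lemma Delta_min u v : exists s, [/\ A s = u - v, Delta u v = D s 0 &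
  forall t, A t = u - v -> Delta u v <= D t 0].
Proof.
have [s [suv smin]] := A_min (u - v).
suff Ds : Delta u v = D s 0 by exists s; split=> // t; rewrite Ds; exact: smin.
have [p [pv _]] := A_small v.
rewrite /Delta; set E := (X in inf X).
have Es : E (D s 0).
  exists (s + p), p; split=> //; last by rewrite [RHS]D_sub addrK.
  by rewrite AD suv pv subrK.
have Elb : lbound E (D s 0).
  by move=> _ [p1 [p2 [p1u p2v ->]]]; rewrite [leRHS]D_sub smin// AB p1u p2v.
apply/eqP; rewrite eq_le; apply/andP; split.
  by apply: ge_inf => //; exists (D s 0).
by apply: lb_le_inf => //; exists (D s 0).
Qed.

Lemma Delta_A p p' : Delta (A p) (A p') <= D p p'.
Proof.
have [s [_ _]] := Delta_min (A p) (A p').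
by rewrite D_sub; apply; rewrite AB.
Qed.

Lemma Delta_attained u v : exists p p',
  [/\ A p = u, A p' = v & Delta u v = D p p'].
Proof.
have [s [suv -> _]] := Delta_min u v; have [p [pv _]] := A_small v.
exists (s + p), p; split=> //; last by rewrite [RHS]D_sub addrK.
by rewrite AD suv pv subrK.
Qed.

Lemma Delta_le_sub u v u' v' : u - v = u' - v' -> Delta u v <= Delta u' v'.
Proof.
move=> uv; have [_ [_ _ min]] := Delta_min u v.
by have [s [suv -> _]] := Delta_min u' v'; apply: min; rewrite uv.
Qed.

Lemma Delta_translation u v w : Delta (u + w) (v + w) = Delta u v.
Proof. by apply/eqP; rewrite eq_le !Delta_le_sub// opprD addrACA subrr addr0. Qed.

Lemma Delta_metric : is_metric (@Delta R r).
Proof.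
have D_ge0 p p' : 0 <= D p p' by exact: le_trans (normr_ge0 _) (D_fst p p').
have Delta_ge0 u v : 0 <= Delta u v.
  by have [p [p' [_ _ ->]]] := Delta_attained u v.
have Delta_leC u v : Delta u v <= Delta v u.
  by have [p [p' [<- <- ->]]] := Delta_attained v u; rewrite DC Delta_A.
split=> [//|u v|u v|u v w].
- split=> [|->].
    by have [p [p' [<- <- ->]]] := Delta_attained u v => /D_eq0->.
  have [p [<- _]] := A_small v; apply/eqP; rewrite eq_le Delta_ge0 andbT.
  apply: le_trans (Delta_A p p) _; rewrite /D subrr normr0 ge_max lexx /=.
  by case: (rhoP R p.2 p.2) => [[_ ->//]|[i []]]; rewrite eqxx.
- by apply/eqP; rewrite eq_le !Delta_leC.
- have [p [p' [pu p'v ->]]] := Delta_attained u v.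
  have [s [s' [sv s'w ->]]] := Delta_attained v w.
  (* Translating (s, s') along the kernel of A makes it start at p'. *)
  have := Delta_A p (s' - (s - p')); rewrite !AB pu p'v sv s'w subrr subr0.
  move=> /le_trans; apply; apply: le_trans (D_triangle p p' _) _.
  by rewrite lerD2l D_sub [leRHS]D_sub opprB addrA [p' + _]addrC subrK.
Qed.

(** Two points of one fibre coincide or have real coordinates at distance at
    least 1. *)
Lemma fibre_dichotomy p p' s : A s = A p - A p' ->
  s = p - p' \/ 1 <= `|p.1 - p'.1| + D s 0.
Proof.
rewrite -AB => e; have [n sn] := A_eq_int e.
have [n0|n0] := eqVneq n 0.
  left; apply: A_inj => //; apply/eqP; rewrite -subr_eq0 sn n0; exact/eqP.
right; have n1 : 1 <= `|n%:~R| :> R.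
  by rewrite -intr_norm (ler_int _ 1) -gtz0_ge1 normr_gt0.
apply: le_trans n1 _; rewrite -sn [leRHS]addrC; apply: le_trans (ler_normB _ _) _.
by rewrite lerD2r; have := D_fst s 0; rewrite subr0.
Qed.

Lemma Delta_embed (x y : Y0 r) : Delta (embed R x) (embed R y) = rho R x y.
Proof.
have A0 (z : Y0 r) : A (0, z) = embed R z.
  by rewrite /A /= -[X in q r X](subrr 0) qB subrr add0r.
have D0 : D (0, x) (0, y) = rho R x y.
  by rewrite /D /= subrr normr0; apply/max_idPr; exact: rho_ge0.
apply/eqP; rewrite eq_le; apply/andP; split.
  by rewrite -!A0 -D0 Delta_A.
have [s []] := Delta_min (embed R x) (embed R y).
rewrite -!A0 => /fibre_dichotomy[->|/= s_large] -> _.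
  by rewrite -D_sub D0.
apply: le_trans (rho_le1 R r_ge2 x y) _.
by rewrite subrr normr0 add0r in s_large.
Qed.

Lemma Delta_le1 u v : Delta u v <= 1.
Proof.
have [s [suv s_small]] := A_small (u - v).
have [_ [_ _ /(_ s suv)]] := Delta_min u v.
move=> /le_trans; apply; rewrite /D ge_max rho_le1// andbT subr0; lra.
Qed.

Lemma D_le_2Delta p p' : `|p.1 - p'.1| <= 1 / 2 ->
  D p p' <= 2 * Delta (A p) (A p').
Proof.
move=> small; have [s []] := Delta_min (A p) (A p').
move=> /fibre_dichotomy[->|s_large] -> _.
  rewrite -D_sub; have := D_fst p p'; have := normr_ge0 (p.1 - p'.1); lra.
apply: (@le_trans _ _ 1); last by lra.
rewrite /D ge_max rho_le1// andbT; lra.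
Qed.

End quotient_metric.

Theorem mainTheorem3 (R : realType) (r : nat -> nat)
    (r_ge2 : forall j : nat, (1 <= j)%N -> (2 <= r j)%N) :
  [/\ (* (1) *)
      [/\ is_metric (@Delta R r),
          forall u v w : Y R r, Delta (u + w) (v + w) = Delta u v &
          forall u v : Y R r, exists p p' : R * Y0 r,
            [/\ A p = u, A p' = v & Delta u v = D p p']],
      (* (2) *)
      forall p p' : R * Y0 r, Delta (A p) (A p') <= D p p',
      (* (3) *)
      forall x y : Y0 r, Delta (embed R x) (embed R y) = rho R x y,
      (* (4) *)
      forall u v : Y R r, Delta u v <= 1 &
      (* (5) *)
      forall p p' : R * Y0 r, `|p.1 - p'.1| <= 1 / 2 ->
        D p p' <= 2 * Delta (A p) (A p')].
Proof.
split.
- split; [exact: Delta_metric | exact: Delta_translation |].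
  exact: Delta_attained.
- exact: Delta_A.
- exact: Delta_embed.
- exact: Delta_le1.
- exact: D_le_2Delta.
Qed.
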